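(* There is an absolute constant $C>0$ such that the following holds. Let $A$ be a real $n\times n$ matrix, let $2<q\le n$, and let $Q$ be a random subset of $\{1,\dots,n\}$ in which each element is included independently with probability $q/n$. Then $$\mathbb E\,\|A|_Q\|_2\ \le\ C\Bigl(\sqrt{\tfrac qn}\,\|A\|_2+\sqrt{\log q}\;\|A\|_{(n/q)}\Bigr).$$
   Context: $\|\cdot\|_2$ is the spectral norm. $A|_Q$ denotes the matrix obtained from $A$ by keeping the columns indexed by $Q$ (equivalently, replacing all columns with index outside $Q$ by zero columns; this does not change the spectral norm). For real $k\ge1$, $\|A\|_{(k)}=\frac1k\sum_{j=1}^{\lfloor k\rfloor}a_j$, where $a_1\ge a_2\ge\dots\ge a_n$ are the Euclidean lengths of the columns of $A$ arranged in nonincreasing order (i.e. essentially the average of the $k$ largest column lengths). *)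

(* Defs.v *)
From HB Require Import structures.
From mathcomp Require Import all_boot all_order all_algebra.
From mathcomp Require Import all_classical all_reals.
From mathcomp Require Import exp.
From mathcomp Require Import Rstruct.
From Stdlib Require Import Reals.
Set Implicit Arguments. Unset Strict Implicit. Unset Printing Implicit Defensive.
Import Order.TTheory GRing.Theory Num.Theory.
Local Open Scope classical_set_scope.
Local Open Scope ring_scope.

Definition vnorm (m : nat) (x : 'cV[R]_m) : R :=
  Num.sqrt (\sum_(i < m) x i ord0 ^+ 2).

Definition spec_norm (m n : nat) (A : 'M[R]_(m, n)) : R :=
  sup [set vnorm (A *m x) | x in [set x : 'cV[R]_n | vnorm x <= 1]].

Definition restr_cols (m n : nat) (A : 'M[R]_(m, n)) (Q : {set 'I_n}) :
  'M[R]_(m, n) := \matrix_(i, j) (if j \in Q then A i j else 0).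

Definition col_len (m n : nat) (A : 'M[R]_(m, n)) (j : 'I_n) : R :=
  vnorm (col j A).

Definition sorted_col_lens (m n : nat) (A : 'M[R]_(m, n)) : seq R :=
  sort (fun a b : R => b <= a) [seq col_len A j | j <- enum 'I_n].

Definition kcol_norm (m n : nat) (A : 'M[R]_(m, n)) (k : R) : R :=
  k^-1 * \sum_(a <- take (Num.truncn k) (sorted_col_lens A)) a.

Definition bern_prob (n : nat) (p : R) (S : {set 'I_n}) : R :=
  p ^+ #|S| * (1 - p) ^+ (n - #|S|).

Definition bern_expect (n : nat) (p : R) (f : {set 'I_n} -> R) : R :=
  \sum_(S : {set 'I_n}) bern_prob p S * f S.

(* Main.v *)
(* Write x_j for the columns of A and k = n/q. The columns longer than the
   floor(k)-th largest length tau are handled by the triangle inequality: their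
   expected total length in Q is at most ||A||_(k). The remaining ones are no
   longer than M = 2 ||A||_(k), and one bounds E ||A|_Q||^2 for them.
   Symmetrization reduces this to the Rademacher average of the norm of
   X = sum_(j in Q) eps_j x_j x_j^T for a fixed Q. By discrete integration by
   parts in the signs, and log-convexity of k |-> x^T H^k x, the moments satisfy
   E tr X^(2k+2) <= 2 (2k+1) M^2 ||A|_Q||^2 E tr X^(2k), and the first step gives
   E tr X^2 <= 2 M^2 ||A|_Q||^2 |Q|; so the dimensional factor is |Q|, which is
   what makes log q rather than log n appear. Taking the moment of order
   2p ~ log q yields E ||A|_Q||^2 <= 2 (q/n) ||A||^2 + 512 p M^2. *)

Require Import Defs.
From HB Require Import structures.
From mathcomp Require Import all_boot all_order all_algebra.
From mathcomp Require Import all_classical all_reals.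
From mathcomp Require Import exp.
From mathcomp Require Import Rstruct.
From Stdlib Require Import Reals.
From mathcomp Require Import ring lra zify.
Set Implicit Arguments. Unset Strict Implicit. Unset Printing Implicit Defensive.
Import Order.TTheory GRing.Theory Num.Theory.
(* Reals rebinds %N to Stdlib's N_scope. *)
Delimit Scope nat_scope with N.
Local Open Scope ring_scope.

(** * Moments of a symmetric matrix at a vector *)

Definition dot (m : nat) (u v : 'cV[R]_m) : R := \sum_i u i ord0 * v i ord0.

Lemma dotE m (u v : 'cV[R]_m) : dot u v = (u^T *m v) ord0 ord0.
Proof. by rewrite mxE; apply: eq_bigr => i _; rewrite mxE. Qed.

Lemma dotC m (u v : 'cV[R]_m) : dot u v = dot v u.
Proof. by apply: eq_bigr => i _; rewrite mulrC. Qed.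

Lemma dotDr m (u v w : 'cV[R]_m) : dot u (v + w) = dot u v + dot u w.
Proof. by rewrite -big_split; apply: eq_bigr => i _; rewrite mxE mulrDr. Qed.

Lemma dotZr m (u v : 'cV[R]_m) a : dot u (a *: v) = a * dot u v.
Proof. by rewrite /dot mulr_sumr; apply: eq_bigr => i _; rewrite mxE mulrCA. Qed.

Lemma dotZl m (u v : 'cV[R]_m) a : dot (a *: u) v = a * dot u v.
Proof. by rewrite dotC dotZr dotC. Qed.

Lemma dot0r m (u : 'cV[R]_m) : dot u 0 = 0.
Proof. by rewrite /dot big1 // => i _; rewrite mxE mulr0. Qed.

Lemma dot_sumr m (u : 'cV[R]_m) (I : finType) (P : pred I) (f : I -> 'cV[R]_m) :
  dot u (\sum_(i | P i) f i) = \sum_(i | P i) dot u (f i).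
Proof. by apply: (big_morph (dot u)) => [v w|]; rewrite ?dotDr ?dot0r. Qed.

Lemma dot_ge0 m (u : 'cV[R]_m) : 0 <= dot u u.
Proof. by apply: sumr_ge0 => i _; rewrite -expr2 sqr_ge0. Qed.

Lemma dot_eq0 m (u : 'cV[R]_m) : dot u u = 0 -> u = 0.
Proof.
move=> /eqP; rewrite psumr_eq0 => [/allP h|i _]; last by rewrite -expr2 sqr_ge0.
apply/colP => i; rewrite mxE; apply/eqP.
by have := h i (mem_index_enum i); rewrite /= mulf_eq0 orbb.
Qed.

Lemma dot_mulmxl m p (B : 'M[R]_(m, p)) u v :
  dot (B *m u) v = dot u (B^T *m v).
Proof. by rewrite !dotE trmx_mul mulmxA. Qed.

Lemma cauchy_schwarz m (u v : 'cV[R]_m) : dot u v ^+ 2 <= dot u u * dot v v.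
Proof.
have [/dot_eq0 ->|v0] := eqVneq (dot v v) 0.
  by rewrite !dot0r expr0n mulr0.
have vv : 0 < dot v v by rewrite lt_def v0 dot_ge0.
have := dot_ge0 (dot v v *: u + (- dot u v) *: v).
rewrite !(dotDr, dotZr) !(dotC (_ + _)) !(dotDr, dotZr) (dotC v u) => h.
have {h}: 0 <= dot v v * (dot u u * dot v v - dot u v ^+ 2).
  by apply: le_trans h _; rewrite le_eqVlt; apply/orP; left; apply/eqP; ring.
by rewrite pmulr_rge0 // subr_ge0.
Qed.

(** For symmetric [H] this is the [k]-th moment of the spectral measure of [H] at [x], of total mass
    [dot x x]. *)
Definition moment m (H : 'M[R]_m) (x : 'cV[R]_m) (k : nat) : R :=
  dot x (H ^+ k *m x).

Lemma moment0 m (H : 'M[R]_m) x : moment H x 0 = dot x x.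
Proof. by rewrite /moment expr0 mul1mx. Qed.

Lemma trmx_exp m (H : 'M[R]_m) k : H^T = H -> (H ^+ k)^T = H ^+ k.
Proof.
move=> sH; elim: k => [|k IH]; first by rewrite expr0 trmx1.
by rewrite exprS -mulmxE trmx_mul IH sH mulmxE -exprSr exprS.
Qed.

Lemma moment_split m (H : 'M[R]_m) x a b : H^T = H ->
  moment H x (a + b) = dot (H ^+ a *m x) (H ^+ b *m x).
Proof.
by move=> sH; rewrite dot_mulmxl trmx_exp // mulmxA mulmxE -exprD.
Qed.

Lemma moment_sqr_le m (H : 'M[R]_m) x a b : H^T = H ->
  moment H x (a + b) ^+ 2 <= moment H x a.*2 * moment H x b.*2.
Proof.
by move=> sH; rewrite -!addnn !moment_split //; exact: cauchy_schwarz.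
Qed.

Lemma moment_even_ge0 m (H : 'M[R]_m) x k : H^T = H -> 0 <= moment H x k.*2.
Proof. by move=> sH; rewrite -addnn moment_split // dot_ge0. Qed.

(** A root-free form of log-convexity between [0] and [r.+1]. In the induction,
    [b r.+1 ^+ 2 <= b r * b r.+2] is raised to the power [r.+1] and [b r.+1 ^+ r] is cancelled. *)
Lemma log_convex_pow_le (b : nat -> R) : (forall k, 0 <= b k) ->
  (forall k, b k.+1 ^+ 2 <= b k * b k.+2) ->
  forall r, b r ^+ r.+1 <= b 0 * b r.+1 ^+ r.
Proof.
move=> b0 bc; elim=> [|r IH]; first by rewrite expr1 expr0 mulr1.
have [->|br0] := eqVneq (b r.+1) 0; first by rewrite expr0n mulr_ge0 ?exprn_ge0.
have br : 0 < b r.+1 by rewrite lt_def br0 b0.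
rewrite -(ler_pM2l (exprn_gt0 r br)).
have -> : b r.+1 ^+ r * b r.+1 ^+ r.+2 = (b r.+1 ^+ 2) ^+ r.+1.
  by rewrite -exprD -exprM; congr (_ ^+ _); lia.
apply: (@le_trans _ _ ((b r * b r.+2) ^+ r.+1)).
  by rewrite lerXn2r ?nnegrE ?sqr_ge0 ?mulr_ge0.
rewrite exprMn mulrCA [leRHS]mulrA.
by rewrite ler_wpM2r ?exprn_ge0.
Qed.

(** Descends one index at a time: the bound at [r.+1] inserted in [log_convex_pow_le] gives the
    bound at [r]. *)
Lemma log_convex_interp (b : nat -> R) (s c : R) :
  (forall k, 0 <= b k) -> (forall k, b k.+1 ^+ 2 <= b k * b k.+2) ->
  0 <= s -> b 0 <= c ->
  forall r, b r <= c * s ^+ r -> forall k, (k <= r)%N -> b k <= c * s ^+ k.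
Proof.
move=> b0 bc s0 bc0; have c0 : 0 <= c := le_trans (b0 0%N) bc0.
elim=> [|r IH] br k; first by rewrite leqn0 => /eqP ->.
rewrite leq_eqVlt => /orP[/eqP -> //|]; rewrite ltnS; apply: IH.
rewrite -(@ler_pXn2r _ r.+1) ?nnegrE ?b0 ?mulr_ge0 ?exprn_ge0 //.
apply: le_trans (log_convex_pow_le b0 bc r) _.
apply: (@le_trans _ _ (c * (c * s ^+ r.+1) ^+ r)).
  by rewrite ler_pM ?exprn_ge0 // lerXn2r ?nnegrE ?mulr_ge0 ?exprn_ge0.
rewrite le_eqVlt !exprMn -!exprM mulrA -exprS; apply/orP; left; apply/eqP.
by congr (_ * _ ^+ _); lia.
Qed.

(** By Cauchy-Schwarz the even moments form a nonnegative log-convex sequence; an odd moment is then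
    controlled by its two even neighbours. *)
Lemma moment_interp m (H : 'M[R]_m) x (t : R) (r : nat) : H^T = H -> 0 <= t ->
  moment H x r.*2 <= dot x x * t ^+ r.*2 ->
  forall k, (k <= r.*2)%N -> `|moment H x k| <= dot x x * t ^+ k.
Proof.
move=> sH t0 hr.
have even k : (k <= r)%N -> moment H x k.*2 <= dot x x * t ^+ k.*2.
  rewrite -[in t ^+ _]mul2n exprM => kr.
  apply: (@log_convex_interp (fun j => moment H x j.*2) _ _ _ _ _ _ r) => //.
  - by move=> j; exact: moment_even_ge0.
  - move=> j; have -> : j.+1.*2 = (j + j.+2)%N by lia.
    exact: moment_sqr_le.
  - exact: sqr_ge0.
  - by rewrite moment0.
  - by rewrite -exprM mul2n.
move=> k kr; have [ko|ke] := boolP (odd k); last first.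
  have -> : k = k./2.*2 by rewrite even_halfK.
  by rewrite ger0_norm ?moment_even_ge0 // even //; lia.
have kE : k = (k./2 + k./2.+1)%N by lia.
have t1 j : 0 <= dot x x * t ^+ j by rewrite mulr_ge0 ?dot_ge0 ?exprn_ge0.
rewrite -(@ler_pXn2r _ 2) ?nnegrE ?normr_ge0 // -normrX ger0_norm ?sqr_ge0 //.
rewrite {1}kE; apply: le_trans (moment_sqr_le _ _ _ sH) _.
have : (k./2.+1 <= r)%N by lia.
move=> k1; apply: (@le_trans _ _
   ((dot x x * t ^+ k./2.*2) * (dot x x * t ^+ k./2.+1.*2))).
  by apply: ler_pM; rewrite ?moment_even_ge0 ?even //; lia.
rewrite mulrACA -exprD exprMn -exprM.
by have -> : (k./2.*2 + k./2.+1.*2 = k * 2)%N by lia.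
Qed.

Lemma root_exists (y : R) N : (0 < N)%N -> 0 <= y ->
  exists2 t : R, 0 <= t & t ^+ N = y.
Proof.
move=> N0 y0; exists (powR y N%:R^-1); first exact: powR_ge0.
by rewrite -powR_mulrn ?powR_ge0 // -powRrM mulVf ?powRr1 // pnatr_eq0 -lt0n.
Qed.

Lemma moment_pair_le m (H K : 'M[R]_m) x a b r : H^T = H -> K^T = K ->
  (a + b = r.*2)%N ->
  `|moment H x a * moment K x b|
    <= dot x x * (moment H x r.*2 + moment K x r.*2).
Proof.
move=> sH sK abr; have H0 := moment_even_ge0 x r sH.
have K0 := moment_even_ge0 x r sK.
have [/dot_eq0 ->|x0] := eqVneq (dot x x) 0.
  by rewrite /moment !mulmx0 !dot0r !mul0r normr0.
have xx : 0 < dot x x by rewrite lt_def x0 dot_ge0.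
have [r0|r0] := posnP r.
  have [-> ->] : a = 0%N /\ b = 0%N by lia.
  rewrite r0 !moment0 normrM ger0_norm ?dot_ge0 // mulrDr lerDl.
  by rewrite mulr_ge0 ?dot_ge0.
(* This [t] makes [dot x x * t ^+ r.*2] the sum of both top moments, so one [t] serves in the
   interpolation for [H] and for [K]. *)
have [t t0 tE] := @root_exists
  ((moment H x r.*2 + moment K x r.*2) / dot x x) r.*2 ltac:(lia)
  (divr_ge0 (addr_ge0 H0 K0) (dot_ge0 x)).
have tE' : dot x x * t ^+ r.*2 = moment H x r.*2 + moment K x r.*2.
  by rewrite tE mulrC divfK.
rewrite -tE' normrM.
have hH := @moment_interp _ _ x _ r sH t0 ltac:(rewrite tE'; lra) a ltac:(lia).
have hK := @moment_interp _ _ x _ r sK t0 ltac:(rewrite tE'; lra) b ltac:(lia).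
apply: le_trans (ler_pM _ _ hH hK) _; rewrite ?normr_ge0 //.
by rewrite mulrACA -exprD abr mulrA.
Qed.

(** * Even trace moments of Rademacher sums of rank-one matrices *)

(** The square of the Frobenius norm. *)
Definition frob (m p : nat) (B : 'M[R]_(m, p)) : R := \sum_i \sum_j B i j ^+ 2.

Lemma dot_row m p (B : 'M[R]_(m, p)) v i : (B *m v) i ord0 = dot (row i B)^T v.
Proof. by rewrite mxE; apply: eq_bigr => j _; rewrite !mxE. Qed.

Lemma frob_row m p (B : 'M[R]_(m, p)) :
  frob B = \sum_i dot (row i B)^T (row i B)^T.
Proof. by apply: eq_bigr => i _; apply: eq_bigr => j _; rewrite !mxE expr2. Qed.

Lemma dot_mulmx_frob m p (B : 'M[R]_(m, p)) v :
  dot (B *m v) (B *m v) <= frob B * dot v v.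
Proof.
rewrite {1}/dot frob_row mulr_suml; apply: ler_sum => i _.
by rewrite !dot_row -expr2 cauchy_schwarz.
Qed.

Lemma trace_even m (H : 'M[R]_m) k : H^T = H ->
  \tr (H ^+ k.*2) = frob (H ^+ k).
Proof.
move=> sH; rewrite -addnn exprD -mulmxE; apply: eq_bigr => i _.
rewrite mxE; apply: eq_bigr => j _; rewrite -[in X in _ * X](trmx_exp _ sH).
by rewrite [in X in _ * X]mxE expr2.
Qed.

Lemma trace_even_ge0 m (H : 'M[R]_m) k : H^T = H -> 0 <= \tr (H ^+ k.*2).
Proof.
move=> /trace_even ->.
by apply: sumr_ge0 => i _; apply: sumr_ge0 => j _; exact: sqr_ge0.
Qed.

Lemma moment_trace_le m (H : 'M[R]_m) v k : H^T = H ->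
  moment H v k.*2 <= dot v v * \tr (H ^+ k.*2).
Proof.
move=> sH; rewrite mulrC trace_even // -addnn moment_split //.
exact: dot_mulmx_frob.
Qed.

(** Here [t] is the Schatten norm of order [2p], which dominates the operator norm. Interpolating
    from the moment of order [2p] down to order 1 avoids eigenvalues. *)
Lemma quad_form_le_root m (H : 'M[R]_m) p : H^T = H -> (0 < p)%N ->
  exists2 t : R, 0 <= t & t ^+ p.*2 = \tr (H ^+ p.*2) /\
    forall v, `|dot v (H *m v)| <= dot v v * t.
Proof.
move=> sH p0.
have [t t0 tE] := @root_exists (\tr (H ^+ p.*2)) p.*2 ltac:(lia)
  (trace_even_ge0 p sH).
exists t => //; split=> // w.
have := @moment_interp _ H w t p sH t0 _ 1%N ltac:(lia).
by rewrite /moment !expr1 tE; apply; exact: moment_trace_le.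
Qed.

Lemma expr_sub_telescope (A : pzRingType) (X Y : A) k :
  X ^+ k.+1 - Y ^+ k.+1 = \sum_(a < k.+1) X ^+ a * (X - Y) * Y ^+ (k - a).
Proof.
elim: k => [|k IH].
  by rewrite big_ord_recl big_ord0 !expr0 !expr1 mul1r mulr1 addr0.
rewrite big_ord_recl expr0 mul1r subn0.
under eq_bigr => a _ do rewrite /= /bump /= add1n subSS exprS -!mulrA.
rewrite -mulr_sumr.
under eq_bigr => a _ do rewrite mulrA.
by apply/esym; rewrite -IH mulrBl mulrBr -!exprS [LHS]addrC addrA subrK.
Qed.

(** The difference of powers telescopes, and the rank-one factor [x *m x^T] cuts each term into a
    product of two scalar moments. *)
Lemma moment_sub m (X Y : 'M[R]_m) x c k : X - Y = c *: (x *m x^T) ->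
  moment X x k.+1 - moment Y x k.+1
    = c * \sum_(a < k.+1) moment X x a * moment Y x (k - a).
Proof.
move=> XY; have oppE : forall w : 'cV[R]_m, - dot x w = dot x (- w).
  by move=> w; rewrite -scaleN1r dotZr mulN1r.
rewrite /moment oppE -dotDr -mulmxBl expr_sub_telescope mulmx_suml dot_sumr.
rewrite mulr_sumr; apply: eq_bigr => a _.
rewrite XY -!mulmxE -scalemxAr -!scalemxAl dotZr; congr (_ * _).
by rewrite !dotE !mulmxA -!(mulmxA (x^T *m X ^+ a *m x)) mxE big_ord1 ?mulmxA.
Qed.

(** A sign pattern is encoded by the set [F] of its positive indices. Rademacher averages appear
    below as plain sums over [F], with the factor [#|{set 'I_n}|] kept on the other side. *)
Definition sgn n (F : {set 'I_n}) (i : 'I_n) : R := if i \in F then 1 else -1.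

Definition flip n (i : 'I_n) (F : {set 'I_n}) : {set 'I_n} :=
  [set j | (j \in F) (+) (j == i)].

Lemma flipK n (i : 'I_n) : involutive (flip i).
Proof. by move=> F; apply/setP => j; rewrite !inE -addbA addbb addbF. Qed.

Lemma sgn_flip n (F : {set 'I_n}) i j :
  sgn (flip i F) j = if j == i then - sgn F j else sgn F j.
Proof.
rewrite /sgn inE; case: (j == i); rewrite ?addbT ?addbF //.
by case: (j \in F); rewrite /= ?opprK.
Qed.

Lemma sgn_sqr n (F : {set 'I_n}) i : sgn F i * sgn F i = 1.
Proof. by rewrite /sgn; case: ifP => _; rewrite ?mulr1 // mulN1r opprK. Qed.

Lemma sgn_norm n (F : {set 'I_n}) i : `|sgn F i| = 1.
Proof. by rewrite /sgn; case: ifP => _; rewrite ?normrN normr1. Qed.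

Definition signed_sum m n (x : 'I_n -> 'cV[R]_m) (Q F : {set 'I_n}) : 'M[R]_m :=
  \sum_(i in Q) sgn F i *: (x i *m (x i)^T).

Section SignedSum.
Variables (m n : nat) (x : 'I_n -> 'cV[R]_m) (Q : {set 'I_n}).
Local Notation X := (signed_sum x Q).

Lemma signed_sum_sym F : (X F)^T = X F.
Proof.
rewrite /signed_sum linear_sum /=.
by apply: eq_bigr => i _; rewrite linearZ /= trmx_mul trmxK.
Qed.

Lemma dot_signed_sum F v :
  dot v (X F *m v) = \sum_(i in Q) sgn F i * dot (x i) v ^+ 2.
Proof.
rewrite /signed_sum mulmx_suml dot_sumr; apply: eq_bigr => i _.
rewrite -scalemxAl dotZr; congr (_ * _).
by rewrite dotE !mulmxA -mulmxA mxE big_ord1 -!dotE (dotC v) expr2.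
Qed.

Lemma trace_signed_sum F (Y : 'M[R]_m) :
  \tr (X F *m Y) = \sum_(i in Q) sgn F i * dot (x i) (Y *m x i).
Proof.
rewrite /signed_sum mulmx_suml raddf_sum; apply: eq_bigr => i _ /=.
rewrite -scalemxAl mxtraceZ; congr (_ * _).
by rewrite -mulmxA mxtrace_mulC dotE mulmxA trace_mx11.
Qed.

Lemma signed_sum_flip F i : i \in Q ->
  X F - X (flip i F) = (2 * sgn F i) *: (x i *m (x i)^T).
Proof.
move=> iQ; rewrite /signed_sum -sumrB (bigD1 i) //= big1 => [|j /andP[_ ji]].
  by rewrite sgn_flip eqxx scaleNr opprK addr0 -scalerDl mulr_natl mulr2n.
by rewrite sgn_flip (negbTE ji) subrr.
Qed.

(* Pairing F with its flip at i turns the sign into a difference of moments. *)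
Lemma rademacher_by_parts i k : i \in Q ->
  \sum_F sgn F i * moment (X F) (x i) k.*2.+1
    <= (2 * k.*2.+1)%:R * dot (x i) (x i) * \sum_F moment (X F) (x i) k.*2.
Proof.
move=> iQ; set S := \sum_F _; pose g F := moment (X F) (x i) k.*2.
have flipS : S = \sum_F sgn F i * - moment (X (flip i F)) (x i) k.*2.+1.
  rewrite /S (reindex_inj (inv_inj (flipK i))) /=; apply: eq_bigr => F _.
  by rewrite sgn_flip eqxx mulNr mulrN.
have flipg : \sum_F g F = \sum_F g (flip i F).
  by rewrite (reindex_inj (inv_inj (flipK i))).
have S2 : S + S = 2 * \sum_F \sum_(a < k.*2.+1)
    moment (X F) (x i) a * moment (X (flip i F)) (x i) (k.*2 - a).
  rewrite {2}flipS /S -big_split mulr_sumr; apply: eq_bigr => F _ /=.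
  rewrite -mulrDr (moment_sub _ (signed_sum_flip F iQ)) !mulrA.
  by rewrite (mulrC _ 2) -!mulrA [sgn F i * _]mulrA sgn_sqr mul1r.
(* Each of the [2k+1] products has total order [2k], so [moment_pair_le] bounds it by the two
   moments of order [2k]; flipping preserves their sum over [F]. *)
have le2 : \sum_F \sum_(a < k.*2.+1)
    moment (X F) (x i) a * moment (X (flip i F)) (x i) (k.*2 - a)
    <= \sum_F k.*2.+1%:R * (dot (x i) (x i) * (g F + g (flip i F))).
  apply: ler_sum => F _; rewrite mulr_natl -[in leRHS](card_ord k.*2.+1).
  rewrite -sumr_const; apply: ler_sum => a _.
  apply: le_trans (ler_norm _) _.
  by apply: moment_pair_le; rewrite ?signed_sum_sym //; have := ltn_ord a; lia.
move: le2; rewrite -!mulr_sumr big_split /= -flipg => le2.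
have -> : (2 * k.*2.+1)%:R = 2 * k.*2.+1%:R :> R by rewrite natrM.
move: S2 le2; rewrite /g; set Z := \sum_F \sum_(a < _) _.
set W := \sum_F _; move: (k.*2.+1%:R : R) => c; nra.
Qed.

Variables (M Lam : R).
Hypothesis (xM : forall i, i \in Q -> dot (x i) (x i) <= M ^+ 2).
Hypothesis (xLam : forall v, \sum_(i in Q) dot (x i) v ^+ 2 <= Lam * dot v v).

(** Expanding along the rows of [X F ^+ k], [xLam] applies to each row, and the squared row lengths
    add up to the trace. Summing over [Q] thus costs [Lam] and not [#|Q|]. *)
Lemma sum_moment_even_le F k :
  \sum_(i in Q) moment (X F) (x i) k.*2 <= Lam * \tr (X F ^+ k.*2).
Proof.
have sX := signed_sum_sym F.
rewrite trace_even // frob_row mulr_sumr.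
have -> : \sum_(i in Q) moment (X F) (x i) k.*2
    = \sum_r \sum_(i in Q) dot (x i) (row r (X F ^+ k))^T ^+ 2.
  rewrite [RHS]exchange_big; apply: eq_bigr => i _ /=.
  rewrite -addnn moment_split //; apply: eq_bigr => r _.
  by rewrite dot_row -expr2 dotC.
by apply: ler_sum => r _; exact: xLam.
Qed.

(** Expanding one factor [X F] of the trace leaves signed odd moments, to which
    [rademacher_by_parts] applies. *)
Lemma trace_step k :
  \sum_F \tr (X F ^+ k.+1.*2)
    <= (2 * k.*2.+1)%:R * M ^+ 2 * \sum_F \sum_(i in Q) moment (X F) (x i) k.*2.
Proof.
under eq_bigr => F _ do rewrite doubleS exprS -mulmxE trace_signed_sum.
rewrite exchange_big [in leRHS]exchange_big mulr_sumr /=.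
apply: ler_sum => i iQ; apply: le_trans (rademacher_by_parts k iQ) _.
rewrite ler_wpM2r ?ler_wpM2l ?ler0n ?xM //.
by apply: sumr_ge0 => F _; rewrite moment_even_ge0 // signed_sum_sym.
Qed.

Hypothesis Lam0 : 0 <= Lam.

Lemma dot_le_Lam i : i \in Q -> dot (x i) (x i) <= Lam.
Proof.
move=> iQ; have [->|xi0] := eqVneq (dot (x i) (x i)) 0; first exact: Lam0.
have xi : 0 < dot (x i) (x i) by rewrite lt_def xi0 dot_ge0.
rewrite -(ler_pM2r xi) -expr2; apply: le_trans _ (xLam (x i)).
by rewrite (bigD1 i) //= lerDl sumr_ge0 // => j _; exact: sqr_ge0.
Qed.

Lemma sum_trace_le p (p0 : (0 < p)%N) :
  \sum_F \tr (X F ^+ p.*2)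
    <= #|{set 'I_n}|%:R * (#|Q|%:R * (4 * p%:R * M ^+ 2 * Lam) ^+ p).
Proof.
have M0 : 0 <= M ^+ 2 := sqr_ge0 M.
suff step k : (k < p)%N -> \sum_F \tr (X F ^+ k.+1.*2)
    <= #|{set 'I_n}|%:R * (#|Q|%:R * (4 * p%:R * M ^+ 2 * Lam) ^+ k.+1).
  by have := step p.-1; rewrite prednK //; apply.
elim: k => [_|k IH kp]; apply: le_trans (trace_step _) _.
  (* At order 0, [sum_moment_even_le] would produce the trace of the identity, that is [m]. Bounding
     each squared length by [Lam] gives the factor [#|Q|] instead. *)
  have -> : \sum_F \sum_(i in Q) moment (X F) (x i) 0.*2
      = #|{set 'I_n}|%:R * \sum_(i in Q) dot (x i) (x i).
    under eq_bigr => F _ do under eq_bigr => i _ do rewrite moment0.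
    by rewrite sumr_const mulr_natl.
  rewrite mulrCA ler_wpM2l ?ler0n // expr1.
  have : \sum_(i in Q) dot (x i) (x i) <= #|Q|%:R * Lam.
    rewrite mulr_natl -sumr_const; apply: ler_sum => i; exact: dot_le_Lam.
  have : 1 <= p%:R :> R by rewrite ler1n.
  have : 0 <= \sum_(i in Q) dot (x i) (x i).
    by apply: sumr_ge0 => i _; exact: dot_ge0.
  have : 0 <= #|Q|%:R :> R by exact: ler0n.
  rewrite muln1; move: (\sum_(i in Q) _) (#|Q|%:R) (p%:R : R) (M ^+ 2) M0.
  move=> s N r W W0 N0 s0 r1 sN.
  apply: (@le_trans _ _ (2 * W * (N * Lam))); first by rewrite ler_wpM2l // mulr_ge0.
  have : 0 <= W * (N * Lam) by rewrite !mulr_ge0.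
  by nra.
have IH' := IH (ltnW kp).
(* The factor [2 * (2j + 1)] with [j = k.+1 < p] is at most [4 * p], uniformly in the induction. *)
apply: (@le_trans _ _ ((4 * p%:R) * M ^+ 2 * (Lam * \sum_F \tr (X F ^+ k.+1.*2)))).
  apply: ler_pM.
  - by rewrite mulr_ge0.
  - apply: sumr_ge0 => F _; apply: sumr_ge0 => i _.
    by rewrite moment_even_ge0 // signed_sum_sym.
  - by rewrite ler_wpM2r // -natrM ler_nat; lia.
  - by rewrite mulr_sumr; apply: ler_sum => F _; exact: sum_moment_even_le.
rewrite [in leRHS]exprS; set D := _ ^+ k.+1 in IH' *.
have -> : #|{set 'I_n}|%:R * (#|Q|%:R * (4 * p%:R * M ^+ 2 * Lam * D))
    = 4 * p%:R * M ^+ 2 * (Lam * (#|{set 'I_n}|%:R * (#|Q|%:R * D))) by ring.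
apply: ler_wpM2l; first by rewrite mulr_ge0 // mulr_ge0.
exact: ler_wpM2l.
Qed.

End SignedSum.

(** * Rademacher average of the quadratic form *)

Definition quad_sup m n (x : 'I_n -> 'cV[R]_m) (u : 'I_n -> R) : R :=
  sup [set \sum_j u j * dot (x j) v ^+ 2 | v in [set v | dot v v <= 1]]%classic.

Section QuadSup.
Variables (m n : nat) (x : 'I_n -> 'cV[R]_m).

Lemma quad_sup_ub u v : dot v v <= 1 ->
  \sum_j u j * dot (x j) v ^+ 2 <= quad_sup x u.
Proof.
move=> v1; apply: ub_le_sup; last by exists v.
exists (\sum_j `|u j| * dot (x j) (x j)) => _ [w /= w1 <-].
apply: ler_sum => j _; apply: (@le_trans _ _ (`|u j| * dot (x j) w ^+ 2)).
  by rewrite ler_wpM2r ?sqr_ge0 // ler_norm.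
rewrite ler_wpM2l //; apply: le_trans (cauchy_schwarz _ _) _.
by rewrite ler_piMr // dot_ge0.
Qed.

Lemma quad_sup_le u c :
  (forall v, dot v v <= 1 -> \sum_j u j * dot (x j) v ^+ 2 <= c) ->
  quad_sup x u <= c.
Proof.
move=> uc; apply: ge_sup => [|_ [v v1 <-]]; last exact: uc.
by eexists; exists 0 => //=; rewrite dot0r ler01.
Qed.

Lemma quad_sup_ge0 u : 0 <= quad_sup x u.
Proof.
apply: le_trans (@quad_sup_ub u 0 _); last by rewrite dot0r ler01.
by rewrite big1 // => j _; rewrite dot0r expr0n mulr0.
Qed.

Lemma quad_supD u w :
  quad_sup x (fun j => u j + w j) <= quad_sup x u + quad_sup x w.
Proof.
apply: quad_sup_le => v v1.
under eq_bigr => j _ do rewrite mulrDl.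
by rewrite big_split lerD //; exact: quad_sup_ub.
Qed.

Lemma eq_quad_sup u w : u =1 w -> quad_sup x u = quad_sup x w.
Proof. by move=> /funext ->. Qed.

(** The squared spectral norm of the matrix with columns [x j], [j \in Q]. *)
Definition col_energy (Q : {set 'I_n}) : R :=
  quad_sup x (fun j => (j \in Q)%:R).

Lemma sum_ind (Q : {set 'I_n}) (f : 'I_n -> R) :
  \sum_j (j \in Q)%:R * f j = \sum_(j in Q) f j.
Proof.
by rewrite [RHS]big_mkcond; apply: eq_bigr => j _; case: ifP; rewrite ?mul1r ?mul0r.
Qed.

Lemma col_energy_ub (Q : {set 'I_n}) v :
  \sum_(i in Q) dot (x i) v ^+ 2 <= col_energy Q * dot v v.
Proof.
have [/dot_eq0 ->|v0] := eqVneq (dot v v) 0.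
  by rewrite dot0r mulr0 big1 // => i _; rewrite dot0r expr0n.
have vv : 0 < dot v v by rewrite lt_def v0 dot_ge0.
have sv : Num.sqrt (dot v v) ^+ 2 = dot v v by rewrite sqr_sqrtr ?dot_ge0.
have := @quad_sup_ub (fun j => (j \in Q)%:R) ((Num.sqrt (dot v v))^-1 *: v).
rewrite sum_ind dotZr dotZl mulrA -expr2 exprVn sv mulVf // => /(_ (lexx _)).
under eq_bigr => i _ do rewrite dotZr exprMn exprVn sv.
by rewrite -mulr_sumr mulrC ler_pdivrMr.
Qed.

(** Bounds [t] by an expression affine in [t ^+ p], so that trace moments can be averaged over the
    signs without a power-mean inequality; [a] is chosen afterwards. *)
Lemma le_add_pow (a t : R) p : (0 < p)%N -> 0 < a -> 0 <= t ->
  t <= a * (1 + t ^+ p / a ^+ p).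
Proof.
move=> p0 a0 t0; rewrite -expr_div_n -{1}(divfK (lt0r_neq0 a0) t) mulrC.
rewrite ler_pM2l //; have : 0 <= t / a by rewrite divr_ge0 // ltW.
move: (t / a) => y y0; have [y1|y1] := leP y 1.
  by apply: le_trans y1 _; rewrite lerDl exprn_ge0.
apply: (@le_trans _ _ (y ^+ p)); last by rewrite lerDr.
by case: p p0 => // p _; rewrite exprS ler_peMr // exprn_ege1 // ltW.
Qed.

Section Rademacher.
Variables (Q : {set 'I_n}) (M q : R) (p : nat).
Hypothesis (xM : forall i, i \in Q -> dot (x i) (x i) <= M ^+ 2).
Hypothesis (p0 : (0 < p)%N).
Hypothesis (q0 : 0 < q).
Hypothesis (qp : q <= 4 ^+ p).

Let sgn_quad F := quad_sup x (fun j => (j \in Q)%:R * sgn F j).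

Lemma sgn_quad_le_trace F (a : R) : 0 < a ->
  sgn_quad F <= a * (1 + \tr (signed_sum x Q F ^+ p.*2) / a ^+ p.*2).
Proof.
move=> a0.
have [t t0 [tE ht]] := quad_form_le_root (signed_sum_sym x Q F) p0.
rewrite -tE; apply: le_trans (@le_add_pow a t p.*2 ltac:(lia) a0 t0).
apply: quad_sup_le => v v1.
under eq_bigr => j _ do rewrite -mulrA.
rewrite sum_ind -dot_signed_sum.
by apply: le_trans (ler_norm _) (le_trans (ht v) _); rewrite ler_piMl.
Qed.

Lemma sgn_quad_le_energy F : sgn_quad F <= col_energy Q.
Proof.
apply: quad_sup_le => v v1; apply: le_trans (@quad_sup_ub _ v v1).
apply: ler_sum => j _; rewrite ler_wpM2r ?sqr_ge0 //.
rewrite ler_piMr // (le_trans (ler_norm _)) // sgn_norm //.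
Qed.

(** The factor [1 + #|Q|%:R / q] accounts for sets larger than [q]; being affine in [#|Q|], it can
    later be averaged over [Q]. *)
Lemma rademacher_energy_le :
  \sum_F sgn_quad F <= #|{set 'I_n}|%:R *
    (col_energy Q / 4 + 64 * p%:R * M ^+ 2 * (1 + #|Q|%:R / q)).
Proof.
set L := col_energy Q; set s := 1 + _ / q.
have L0 : 0 <= L := quad_sup_ge0 _.
have N0 : 0 <= #|Q|%:R :> R := ler0n _ _.
have s1 : 1 <= s by rewrite lerDl divr_ge0 // ltW.
have c0 : 0 <= p%:R * M ^+ 2 :> R by rewrite mulr_ge0 ?sqr_ge0.
have cs0 : 0 <= p%:R * M ^+ 2 * s by rewrite mulr_ge0 //; lra.
have [Lz|Ln] := eqVneq L 0.
  apply: (@le_trans _ _ 0); last by rewrite mulr_ge0 // Lz; lra.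
  by apply: sumr_le0 => F _; rewrite -Lz sgn_quad_le_energy.
(* The final bound is [2 * a] per sign pattern, which fixes both coefficients; it suffices that
   [a ^+ p.*2] dominates the averaged trace. *)
pose a := L / 8 + 32 * (p%:R * M ^+ 2 * s).
have Lp : 0 < L by rewrite lt_def Ln.
have a0 : 0 < a by rewrite /a; lra.
pose B := 4 * p%:R * M ^+ 2 * L.
have B0 : 0 <= B by rewrite /B; nra.
(* AM-GM on the two summands of a *)
have aB : 4 * s * B <= a ^+ 2.
  rewrite -subr_ge0; have -> : a ^+ 2 - 4 * s * B
      = (L / 8 - 32 * (p%:R * M ^+ 2 * s)) ^+ 2 by rewrite /a /B; field.
  exact: sqr_ge0.
have NB : #|Q|%:R * B ^+ p <= a ^+ p.*2.
  (* The dimensional factor is absorbed into the power [p]: [#|Q| <= q * s], [q <= 4 ^+ p], and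
     [s <= s ^+ p] since [s >= 1]. *)
  have qs : #|Q|%:R <= 4 ^+ p * s ^+ p.
    apply: (@le_trans _ _ (q * s)).
      by rewrite /s mulrDr mulr1 mulrCA divff ?gt_eqF // mulr1 lerDr ltW.
    apply: ler_pM => //; [exact: ltW|lra|].
    by case: p p0 => // k _; rewrite exprS ler_peMr ?exprn_ege1 //; lra.
  rewrite -mul2n exprM; apply: (@le_trans _ _ ((4 * s * B) ^+ p)).
    by rewrite (exprMn p (4 * s) B) (exprMn p 4 s) ler_wpM2r // exprn_ge0.
  have s4B : 0 <= 4 * s * B by rewrite mulr_ge0 //; lra.
  by rewrite lerXn2r ?nnegrE ?sqr_ge0.
have := @sum_trace_le _ _ x Q M L xM (col_energy_ub Q) L0 p p0.
rewrite -/B => htr.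
apply: (@le_trans _ _ (\sum_F a * (1 + \tr (signed_sum x Q F ^+ p.*2) / a ^+ p.*2))).
  by apply: ler_sum => F _; exact: sgn_quad_le_trace.
rewrite -mulr_sumr big_split /= sumr_const -mulr_suml.
have ap : 0 < a ^+ p.*2 by rewrite exprn_gt0.
have : (\sum_F \tr (signed_sum x Q F ^+ p.*2)) / a ^+ p.*2 <= #|{set 'I_n}|%:R.
  rewrite ler_pdivrMr //; apply: le_trans htr _.
  by rewrite ler_wpM2l.
move=> h; apply: (@le_trans _ _ (a * (#|{set 'I_n}|%:R + #|{set 'I_n}|%:R))).
  by rewrite ler_pM2l // lerD2l.
by rewrite /a le_eqVlt; apply/orP; left; apply/eqP; field.
Qed.

End Rademacher.
End QuadSup.

(** * Symmetrization of the Bernoulli selection *)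

Lemma bern_prob_prod n (p : R) (S : {set 'I_n}) :
  bern_prob p S = \prod_j (if j \in S then p else 1 - p).
Proof.
rewrite (bigID (mem S)) /=; congr (_ * _).
  by under eq_bigr => j jS do rewrite jS; rewrite prodr_const.
under eq_bigr => j jS do rewrite (negbTE jS).
rewrite (eq_bigl (fun j => j \in ~: S)) => [|j]; last by rewrite inE.
by rewrite prodr_const [in RHS]cardsCs finset.setCK card_ord.
Qed.

(** Passing from [(S, T)] to [(mix F S T, mix F T S)] exchanges the two sets outside [F]. *)
Definition mix n (F S T : {set 'I_n}) : {set 'I_n} :=
  [set j | if j \in F then j \in S else j \in T].

Section Bernoulli.
Variables (n : nat) (p : R).
Hypothesis (p01 : 0 <= p <= 1).
Implicit Types (f g : {set 'I_n} -> R).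
Local Notation E := (@bern_expect n p).

Lemma bern_prob_ge0 (S : {set 'I_n}) : 0 <= bern_prob p S.
Proof.
case/andP: p01 => p0 p1.
by apply: mulr_ge0; apply: exprn_ge0 => //; rewrite subr_ge0.
Qed.

Lemma bern_expect_le f g : (forall S, f S <= g S) -> E f <= E g.
Proof. by move=> fg; apply: ler_sum => S _; rewrite ler_wpM2l ?bern_prob_ge0. Qed.

Lemma bern_expectD f g : E (fun S => f S + g S) = E f + E g.
Proof. by rewrite -big_split; apply: eq_bigr => S _; rewrite mulrDr. Qed.

Lemma bern_expectZ a f : E (fun S => a * f S) = a * E f.
Proof. by rewrite /bern_expect mulr_sumr; apply: eq_bigr => S _; rewrite mulrCA. Qed.

Lemma bern_expect_sum (I : finType) (P : pred I) (f : I -> {set 'I_n} -> R) :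
  E (fun S => \sum_(i | P i) f i S) = \sum_(i | P i) E (f i).
Proof.
by rewrite exchange_big; apply: eq_bigr => S _; rewrite mulr_sumr.
Qed.

Lemma bern_expect_cst a : E (fun=> a) = a.
Proof.
rewrite /bern_expect -mulr_suml -[RHS]mul1r; congr (_ * _).
under eq_bigr => S _ do rewrite bern_prob_prod.
by rewrite -bigA_distr big1 // => j _; exact: subrKC.
Qed.

Lemma bern_expect_mem j : E (fun S => (j \in S)%:R) = p.
Proof.
(* The zero at [j] kills the sets that omit [j], so the indicator is absorbed in a product weight
   and the sum over sets factorizes. *)
pose G i := if i == j then 0 else 1 - p.
have -> : E (fun S => (j \in S)%:R)
    = \sum_(S : {set 'I_n}) \prod_i (if i \in S then p else G i).
  apply: eq_bigr => S _; rewrite bern_prob_prod.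
  rewrite (bigD1 j) // [in RHS](bigD1 j) //= /G eqxx.
  case: ifP => jS; rewrite ?mulr0 ?mul0r // mulr1; congr (_ * _).
  by apply: eq_bigr => i /negbTE ->.
rewrite -bigA_distr (bigD1 j) //= big1 => [|i /negbTE ij].
  by rewrite /G eqxx addr0 mulr1.
by rewrite /G ij; exact: subrKC.
Qed.

Lemma bern_expect_sum_mem (w : 'I_n -> R) :
  E (fun S => \sum_j (j \in S)%:R * w j) = p * \sum_j w j.
Proof.
rewrite bern_expect_sum mulr_sumr; apply: eq_bigr => j _.
rewrite -[in RHS](bern_expect_mem j) mulr_suml; apply: eq_bigr => S _.
by rewrite mulrA.
Qed.

Lemma bern_expect_card : E (fun S => #|S|%:R) = p * n%:R.
Proof.
have -> : E (fun S => #|S|%:R) = E (fun S => \sum_j (j \in S)%:R * 1).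
  by apply: eq_bigr => S _; rewrite sum_ind sumr_const.
by rewrite bern_expect_sum_mem sumr_const card_ord.
Qed.

Lemma mixK (F S T : {set 'I_n}) : mix F (mix F S T) (mix F T S) = S.
Proof. by apply/setP => j; rewrite !inE; case: (j \in F). Qed.

(** The exchange is an involution on pairs and preserves the product weight coordinate by
    coordinate. *)
Lemma bern_expect_swap (F : {set 'I_n}) (f : {set 'I_n} -> {set 'I_n} -> R) :
  E (fun S => E (f S)) = E (fun S => E (fun T => f (mix F S T) (mix F T S))).
Proof.
have pairE (g : {set 'I_n} -> {set 'I_n} -> R) : E (fun S => E (g S))
    = \sum_(z : {set 'I_n} * {set 'I_n})
        bern_prob p z.1 * bern_prob p z.2 * g z.1 z.2.
  rewrite -(pair_bigA _ (fun S T => bern_prob p S * bern_prob p T * g S T)).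
  apply: eq_bigr => S _; rewrite mulr_sumr.
  by apply: eq_bigr => T _; rewrite mulrA.
pose h (z : {set 'I_n} * {set 'I_n}) := (mix F z.1 z.2, mix F z.2 z.1).
have hK : involutive h by case=> S T; rewrite /h /= !mixK.
rewrite !pairE (reindex_inj (inv_inj hK)); apply: eq_bigr => -[S T] _ /=.
congr (_ * _); rewrite !bern_prob_prod -!big_split; apply: eq_bigr => j _ /=.
by rewrite !inE; case: (j \in F) => //; rewrite mulrC.
Qed.

Section Symmetrization.
Variables (m : nat) (x : 'I_n -> 'cV[R]_m).
Let sgn_quad (F S : {set 'I_n}) := quad_sup x (fun j => (j \in S)%:R * sgn F j).
Let diff_quad (S T : {set 'I_n}) :=
  quad_sup x (fun j => (j \in S)%:R - (j \in T)%:R).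

(** With [T] an independent copy, the full form times [p] is the mean of the form of [T]; a supremum
    of means is at most the mean of the suprema. *)
Lemma energy_le_diff S :
  col_energy x S <= p * col_energy x [set: 'I_n] + E (diff_quad S).
Proof.
apply: quad_sup_le => v v1.
have -> : \sum_j (j \in S)%:R * dot (x j) v ^+ 2
    = p * (\sum_(j in [set: 'I_n]) dot (x j) v ^+ 2) +
      E (fun T => \sum_j ((j \in S)%:R - (j \in T)%:R) * dot (x j) v ^+ 2).
  have -> : E (fun T => \sum_j ((j \in S)%:R - (j \in T)%:R) * dot (x j) v ^+ 2)
      = E (fun T => \sum_j (j \in S)%:R * dot (x j) v ^+ 2
           + -1 * \sum_j (j \in T)%:R * dot (x j) v ^+ 2).
    congr bern_expect; apply/funext => T; rewrite mulN1r -sumrB.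
    by apply: eq_bigr => j _; rewrite mulrBl.
  rewrite bern_expectD bern_expect_cst bern_expectZ bern_expect_sum_mem.
  rewrite [\sum_(j in finset.setT) _](eq_bigl xpredT) => [|j]; last by rewrite !inE.
  by ring.
apply: lerD.
  rewrite ler_wpM2l //; first by case/andP: p01.
  by rewrite -sum_ind; exact: quad_sup_ub.
by apply: bern_expect_le => T; exact: quad_sup_ub.
Qed.

Lemma sgn_setC (F : {set 'I_n}) j : sgn (~: F) j = - sgn F j.
Proof. by rewrite /sgn inE; case: (j \in F); rewrite ?opprK. Qed.

(** After the exchange, the difference of indicators equals [sgn F] times that of [S] and [T];
    subadditivity separates [S] from [T]. *)
Lemma diff_quad_mix (F S T : {set 'I_n}) :
  diff_quad (mix F S T) (mix F T S) <= sgn_quad F S + sgn_quad (~: F) T.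
Proof.
apply: le_trans (quad_supD _ _ _); rewrite le_eqVlt; apply/orP; left.
apply/eqP/eq_quad_sup => j; rewrite sgn_setC /sgn !inE.
by case: (j \in F); rewrite ?opprK ?mulr1 ?mulrN1 // addrC.
Qed.

(** The exchange is summed over all [F]; complementing [F] shows that the two sign sums agree,
    whence the factor 2. *)
Lemma symmetrization : #|{set 'I_n}|%:R * E (col_energy x) <=
  #|{set 'I_n}|%:R * (p * col_energy x [set: 'I_n])
  + 2 * E (fun S => \sum_F sgn_quad F S).
Proof.
have : E (col_energy x)
    <= p * col_energy x [set: 'I_n] + E (fun S => E (diff_quad S)).
  apply: le_trans (bern_expect_le energy_le_diff) _.
  by rewrite bern_expectD bern_expect_cst.
have diffE : #|{set 'I_n}|%:R * E (fun S => E (diff_quad S))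
    <= 2 * E (fun S => \sum_F sgn_quad F S).
  rewrite mulr_natl -sumr_const.
  apply: (@le_trans _ _ (\sum_(F : {set 'I_n})
     E (fun S => E (fun T => sgn_quad F S + sgn_quad (~: F) T)))).
    apply: ler_sum => F _; rewrite (bern_expect_swap F).
    by apply: bern_expect_le => S; apply: bern_expect_le => T; exact: diff_quad_mix.
  have -> : \sum_(F : {set 'I_n})
      E (fun S => E (fun T => sgn_quad F S + sgn_quad (~: F) T))
      = \sum_F (E (sgn_quad F) + E (sgn_quad (~: F))).
    apply: eq_bigr => F _; rewrite -[in X in _ + X](bern_expect_cst (E (sgn_quad (~: F)))).
    rewrite -bern_expectD; congr bern_expect; apply/funext => S.
    by rewrite bern_expectD bern_expect_cst.
  rewrite big_split /= [X in _ + X](_ : _ = \sum_F E (sgn_quad F)).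
    by rewrite bern_expect_sum mulr_natl mulr2n.
  rewrite [RHS](reindex_inj (inv_inj (@finset.setCK _))) //.
by move=> h; rewrite (le_trans (ler_wpM2l _ h)) ?ler0n // mulrDr lerD2l.
Qed.

Lemma bern_energy_le (M : R) (k : nat) :
  (forall i, dot (x i) (x i) <= M ^+ 2) -> (0 < k)%N ->
  0 < p * n%:R -> p * n%:R <= 4 ^+ k ->
  E (col_energy x)
    <= 2 * (p * col_energy x [set: 'I_n]) + 512 * k%:R * M ^+ 2.
Proof.
move=> xM k0 q0 qk.
have N0 : 0 < #|{set 'I_n}|%:R :> R by rewrite ltr0n; apply/card_gt0P; exists finset.set0.
have : E (fun S => \sum_F sgn_quad F S) <= #|{set 'I_n}|%:R *
    (E (col_energy x) / 4 + 128 * k%:R * M ^+ 2).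
  apply: (@le_trans _ _ (E (fun S => #|{set 'I_n}|%:R *
    (col_energy x S / 4 + 64 * k%:R * M ^+ 2 * (1 + #|S|%:R / (p * n%:R)))))).
    by apply: bern_expect_le => S; apply: rademacher_energy_le.
  rewrite bern_expectZ ler_pM2l // bern_expectD.
  have -> : E (fun S => col_energy x S / 4) = E (col_energy x) / 4.
    by rewrite mulrC -bern_expectZ; congr bern_expect; apply/funext => S; rewrite mulrC.
  rewrite bern_expectZ bern_expectD bern_expect_cst.
  have -> : E (fun S => #|S|%:R / (p * n%:R)) = 1.
    rewrite (_ : (fun S => _) = (fun S : {set 'I_n} => (p * n%:R)^-1 * #|S|%:R)).
      by rewrite bern_expectZ bern_expect_card mulVf ?gt_eqF.
    by apply/funext => S; rewrite mulrC.
  by rewrite lerD2l; lra.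
(* Symmetrization doubles the term [E (col_energy x) / 4]; the resulting half is moved to the left,
   which doubles the remaining constants. *)
have := symmetrization; rewrite -subr_ge0.
set e := E (col_energy x); set t := p * col_energy _ _.
set z := E (fun S => \sum_F _) => h1 h2; rewrite -(ler_pM2l N0); lra.
Qed.

End Symmetrization.
End Bernoulli.

(** * Spectral norm and column lengths *)

Lemma vnormE m (x : 'cV[R]_m) : vnorm x = Num.sqrt (dot x x).
Proof. by congr Num.sqrt; apply: eq_bigr => i _; rewrite expr2. Qed.

Lemma vnorm_sqr m (x : 'cV[R]_m) : vnorm x ^+ 2 = dot x x.
Proof. by rewrite vnormE sqr_sqrtr // dot_ge0. Qed.

Lemma vnorm_ge0 m (x : 'cV[R]_m) : 0 <= vnorm x.
Proof. exact: sqrtr_ge0. Qed.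

Lemma vnorm_le m (x : 'cV[R]_m) c : 0 <= c -> (vnorm x <= c) = (dot x x <= c ^+ 2).
Proof. by move=> c0; rewrite -vnorm_sqr ler_pXn2r ?nnegrE ?vnorm_ge0. Qed.

Lemma vnormD m (x y : 'cV[R]_m) : vnorm (x + y) <= vnorm x + vnorm y.
Proof.
rewrite vnorm_le ?addr_ge0 ?vnorm_ge0 //.
rewrite dotDr !(dotC (x + y)) !dotDr (dotC y x) sqrrD !vnorm_sqr.
have : dot x y <= vnorm x * vnorm y.
  apply: le_trans (ler_norm _) _.
  rewrite -(@ler_pXn2r _ 2) ?nnegrE ?normr_ge0 ?mulr_ge0 ?vnorm_ge0 //.
  by rewrite exprMn !vnorm_sqr -normrX ger0_norm ?sqr_ge0 // cauchy_schwarz.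
by lra.
Qed.

Section SpectralNorm.
Variables (m n : nat).
Implicit Types (A B : 'M[R]_(m, n)).

Lemma spec_norm_ub A v : dot v v <= 1 -> vnorm (A *m v) <= spec_norm A.
Proof.
move=> v1; apply: ub_le_sup; last first.
  by exists v => //=; rewrite vnorm_le ?ler01 // expr1n.
exists (Num.sqrt (frob A)) => _ [w /= w1 <-].
have {}w1 : dot w w <= 1 by move: w1; rewrite vnorm_le // expr1n.
have f0 : 0 <= frob A.
  by apply: sumr_ge0 => i _; apply: sumr_ge0 => j _; exact: sqr_ge0.
rewrite vnorm_le ?sqrtr_ge0 // sqr_sqrtr //.
by apply: le_trans (dot_mulmx_frob _ _) _; rewrite ler_piMr.
Qed.

Lemma spec_norm_le A c :
  (forall v, dot v v <= 1 -> vnorm (A *m v) <= c) -> spec_norm A <= c.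
Proof.
move=> Ac; apply: ge_sup => [|_ [v /= v1 <-]].
  by eexists; exists 0 => //=; rewrite vnorm_le // dot0r expr1n.
by apply: Ac; move: v1; rewrite vnorm_le // expr1n.
Qed.

Lemma spec_norm_ge0 A : 0 <= spec_norm A.
Proof.
apply: le_trans (vnorm_ge0 (A *m 0)) (spec_norm_ub _ _).
by rewrite dot0r.
Qed.

Lemma spec_normD A B : spec_norm (A + B) <= spec_norm A + spec_norm B.
Proof.
apply: spec_norm_le => v v1; rewrite mulmxDl.
by apply: le_trans (vnormD _ _) _; rewrite lerD ?spec_norm_ub.
Qed.

Lemma dot_mulmx_spec A v :
  dot (A *m v) (A *m v) <= spec_norm A ^+ 2 * dot v v.
Proof.
have [/dot_eq0 ->|v0] := eqVneq (dot v v) 0; first by rewrite mulmx0 !dot0r mulr0.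
have vv : 0 < dot v v by rewrite lt_def v0 dot_ge0.
have sv : Num.sqrt (dot v v) ^+ 2 = dot v v by rewrite sqr_sqrtr ?dot_ge0.
have := @spec_norm_ub A ((Num.sqrt (dot v v))^-1 *: v).
rewrite dotZr dotZl mulrA -expr2 exprVn sv mulVf // => /(_ (lexx _)).
rewrite vnorm_le ?spec_norm_ge0 // -scalemxAr dotZr dotZl mulrA -expr2 exprVn sv.
by rewrite mulrC ler_pdivrMr.
Qed.

Lemma sum_dot_col A w :
  \sum_j dot (col j A) w ^+ 2 = dot (A^T *m w) (A^T *m w).
Proof. by apply: eq_bigr => j _; rewrite dot_row tr_row trmxK expr2. Qed.

(** This is the bound of the norm of [A^T] by that of [A]: for [u = A^T *m v], apply Cauchy-Schwarz
    to [dot u u = dot (A *m u) v] and cancel [dot u u]. *)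
Lemma col_energy_spec_norm A :
  col_energy (fun j => col j A) [set: 'I_n] <= spec_norm A ^+ 2.
Proof.
apply: quad_sup_le => v v1; rewrite sum_ind.
rewrite (eq_bigl xpredT) => [|j]; last by rewrite !inE.
rewrite sum_dot_col; set u := A^T *m v.
have uE : dot u u = dot (A *m u) v by rewrite dot_mulmxl.
have [->|u0] := eqVneq (dot u u) 0; first exact: sqr_ge0.
have uu : 0 < dot u u by rewrite lt_def u0 dot_ge0.
rewrite -(ler_pM2r uu) -expr2 {1}uE; apply: le_trans (cauchy_schwarz _ _) _.
apply: le_trans (dot_mulmx_spec A u).
by rewrite ler_piMr // dot_ge0.
Qed.

Lemma col_restr A (Q : {set 'I_n}) j :
  col j (restr_cols A Q) = (j \in Q)%:R *: col j A.
Proof. by apply/colP => i; rewrite !mxE; case: ifP; rewrite ?mul1r ?mul0r. Qed.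

(** The dual argument: for [w = B *m v], apply Cauchy-Schwarz to [dot w w = dot v (B^T *m w)] and
    cancel [dot w w]. *)
Lemma spec_norm_restr_energy A (Q : {set 'I_n}) :
  spec_norm (restr_cols A Q) ^+ 2 <= col_energy (fun j => col j A) Q.
Proof.
set B := restr_cols A Q; set L := col_energy _ Q.
have L0 : 0 <= L := quad_sup_ge0 _ _.
suff : spec_norm B <= Num.sqrt L.
  by move=> h; rewrite -(sqr_sqrtr L0) lerXn2r ?nnegrE ?spec_norm_ge0 ?sqrtr_ge0.
apply: spec_norm_le => v v1; rewrite vnorm_le ?sqrtr_ge0 // sqr_sqrtr //.
set w := B *m v.
have [->//|w0] := eqVneq (dot w w) 0.
have ww : 0 < dot w w by rewrite lt_def w0 dot_ge0.
have wE : dot w w = dot v (B^T *m w) by rewrite {1}/w dot_mulmxl.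
rewrite -(ler_pM2r ww) -expr2 {1}wE.
apply: le_trans (cauchy_schwarz _ _) _.
have -> : dot (B^T *m w) (B^T *m w) = \sum_(j in Q) dot (col j A) w ^+ 2.
  rewrite -sum_dot_col -sum_ind; apply: eq_bigr => j _.
  by rewrite col_restr dotZl exprMn; case: (j \in Q); rewrite ?expr1n ?expr0n.
apply: le_trans _ (@col_energy_ub _ _ (fun j => col j A) Q w).
by rewrite ler_piMl // sumr_ge0 // => j _; exact: sqr_ge0.
Qed.

Lemma col_len_ge0 A j : 0 <= col_len A j. Proof. exact: vnorm_ge0. Qed.

Lemma spec_norm_restr_sum A (Q : {set 'I_n}) :
  spec_norm (restr_cols A Q) <= \sum_(j in Q) col_len A j.
Proof.
set S := \sum_(j in Q) _.
have S0 : 0 <= S by apply: sumr_ge0 => j _; exact: col_len_ge0.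
rewrite -(@ler_pXn2r _ 2) ?nnegrE ?spec_norm_ge0 //.
apply: le_trans (spec_norm_restr_energy A Q) _; apply: quad_sup_le => v v1.
rewrite sum_ind expr2 {1}/S mulr_suml; apply: ler_sum => j jQ.
apply: le_trans (cauchy_schwarz _ _) _; rewrite -vnorm_sqr.
apply: (@le_trans _ _ (vnorm (col j A) ^+ 2)); first by rewrite ler_piMr ?sqr_ge0.
rewrite expr2 ler_wpM2l ?vnorm_ge0 // /S (bigD1 j) //= lerDl.
by apply: sumr_ge0 => i _; exact: col_len_ge0.
Qed.

Lemma spec_norm_restr_le A (Q : {set 'I_n}) :
  spec_norm (restr_cols A Q) <= spec_norm A.
Proof.
apply: spec_norm_le => v v1.
pose w : 'cV[R]_n := \col_j (if j \in Q then v j ord0 else 0).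
have -> : restr_cols A Q *m v = A *m w.
  apply/colP => i; rewrite !mxE; apply: eq_bigr => j _; rewrite !mxE.
  by case: ifP; rewrite ?mulr0 ?mul0r.
apply: spec_norm_ub; apply: le_trans v1; apply: ler_sum => j _.
by rewrite !mxE; case: ifP; rewrite // mulr0 -expr2 sqr_ge0.
Qed.

Lemma restr_cols_split A (L Q : {set 'I_n}) :
  restr_cols A Q = restr_cols (restr_cols A (~: L)) Q + restr_cols A (Q :&: L).
Proof.
apply/matrixP => i j; rewrite !mxE !inE.
by case: (j \in Q); case: (j \in L); rewrite /= ?add0r ?addr0.
Qed.

End SpectralNorm.

(** * The largest terms of a nonincreasing sequence *)

Section TopOfSortedSequence.
Variables (s : seq R) (k : nat).
Hypothesis (s_sorted : sorted (fun a b : R => b <= a) s).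
Hypothesis (s_ge0 : forall a, a \in s -> 0 <= a).
Hypothesis (k_gt0 : (0 < k)%N).
Hypothesis (k_le : (k <= size s)%N).
(** Indices start at 0, so this is the [k]-th largest term. *)
Let tau := nth 0 s k.-1.

Let nth_ge i j : (i <= j)%N -> (j < size s)%N -> nth 0 s j <= nth 0 s i.
Proof.
move=> ij js; have trans : transitive (fun a b : R => b <= a).
  by move=> a b c ba ac; exact: le_trans ac ba.
by apply: (sorted_leq_nth trans _ 0 s_sorted) => //; rewrite inE; lia.
Qed.

Lemma mulr_threshold_le : k%:R * tau <= \sum_(a <- take k s) a.
Proof.
have -> : k%:R * tau = \sum_(a <- take k s) tau.
  by rewrite big_const_seq count_predT size_takel // iter_addr_0 mulr_natl.
rewrite big_seq [leRHS]big_seq; apply: ler_sum => a /(nthP 0)[i].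
rewrite size_takel // => ik <-; rewrite nth_take //; apply: nth_ge; lia.
Qed.

Lemma sum_above_threshold_le :
  \sum_(a <- s | tau < a) a <= \sum_(a <- take k s) a.
Proof.
rewrite -{1}(cat_take_drop k s) big_cat /= [X in _ + X]big1_seq.
  rewrite addr0 big_mkcond big_seq [leRHS]big_seq; apply: ler_sum => a /mem_take as_.
  by case: ifP => // _; exact: s_ge0.
move=> a /andP[ta /(nthP 0)[i]]; rewrite size_drop => iks aE.
move: ta; rewrite -aE nth_drop ltNge nth_ge //.
  exact: leq_trans (leq_pred k) (leq_addr i k).
by rewrite -ltn_subRL.
Qed.

End TopOfSortedSequence.

(** * Second moments, the choice of the moment order, and the final bound *)

Lemma bern_expect_sqr_le n (p : R) (f : {set 'I_n} -> R) : 0 <= p <= 1 ->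
  bern_expect p f ^+ 2 <= bern_expect p (fun S => f S ^+ 2).
Proof.
move=> p01; set e := bern_expect p f.
(* The integrand is the square of [f S - e]: the variance is nonnegative. *)
have : 0 <= bern_expect p (fun S => (f S ^+ 2 + (- 2 * e) * f S) + e ^+ 2).
  rewrite -[leLHS](bern_expect_cst n p); apply: bern_expect_le => // S.
  by have := sqr_ge0 (f S - e); lra.
by rewrite !bern_expectD bern_expectZ bern_expect_cst -/e; lra.
Qed.

Lemma le_pow4_ln (q : R) k : 0 < q -> ln q <= k%:R -> q <= 4 ^+ k.
Proof.
move=> /RltP q0 qk; rewrite -(exp_ln q q0).
apply: (@le_trans _ _ (exp k%:R)).
  have [->|/eqP h] := eqVneq (ln q) k%:R => //.
  by apply/ltW/RltP/exp_increasing/RltP; rewrite lt_neqAle qk andbT; apply/eqP.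
rewrite -expRX lerXn2r ?nnegrE //; first by apply/ltW/RltP/exp_pos.
apply: (@le_trans _ _ 3); last by rewrite ler_nat.
by apply/RleP; have := exp_le_3; rewrite IZRposE INRE.
Qed.

Lemma half_le_ln (q : R) : 2 < q -> 1 / 2 <= ln q.
Proof.
move=> q2; have /RltP h2 := ln_lt_2.
have : ln 2%:R <= ln q.
  apply/ltW/RltP/ln_increasing; first by apply/RltP; rewrite ltr0n.
  exact/RltP.
have {h2} : 2%:R^-1 < ln 2%:R by move: h2; rewrite IZRposE INRE RinvE.
by lra.
Qed.

Lemma bern_spec_norm_le m n (A : 'M[R]_(m, n)) (p M : R) (k : nat) :
  0 <= p <= 1 -> (forall j, col_len A j <= M) -> (0 < k)%N ->
  0 < p * n%:R -> p * n%:R <= 4 ^+ k ->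
  bern_expect p (fun Q => spec_norm (restr_cols A Q)) ^+ 2
    <= 2 * (p * spec_norm A ^+ 2) + 512 * k%:R * M ^+ 2.
Proof.
move=> p01 AM k0 q0 qk; apply: le_trans (bern_expect_sqr_le _ p01) _.
have x_le j : dot (col j A) (col j A) <= M ^+ 2.
  by rewrite -vnorm_sqr lerXn2r ?nnegrE ?vnorm_ge0 ?AM // (le_trans _ (AM j)) ?vnorm_ge0.
have := @bern_energy_le n p p01 m (fun j => col j A) M k x_le k0 q0 qk.
set E := bern_expect _ _ => hE.
apply: (@le_trans _ _ E).
  by apply: bern_expect_le => // Q; exact: spec_norm_restr_energy.
apply: le_trans hE _; rewrite lerD2r ler_pM2l // ler_wpM2l //.
  by case/andP: p01.
exact: col_energy_spec_norm.
Qed.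

Lemma moment_order_exists (q : R) : 2 < q ->
  exists k : nat, [/\ (0 < k)%N, q <= 4 ^+ k & k%:R <= 3 * ln q].
Proof.
move=> q2; have lnq := half_le_ln q2.
have l0 : 0 <= ln q by lra.
have [t /andP[tq qt]] : exists t : nat, t%:R <= ln q < t.+1%:R.
  by exists (Num.truncn (ln q)); exact: truncn_itv.
(* The order is [floor (ln q) + 1], at most [3 * ln q] because [ln q >= 1 / 2]. *)
exists t.+1; split=> //; first by apply: le_pow4_ln; [lra|exact: ltW].
by rewrite -natr1; lra.
Qed.

Lemma large_columns m n (A : 'M[R]_(m, n)) k : (0 < k)%N -> (k <= n)%N ->
  exists L : {set 'I_n},
    \sum_(j in L) col_len A j <= \sum_(a <- take k (sorted_col_lens A)) a /\
    forall j, j \notin L ->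
      k%:R * col_len A j <= \sum_(a <- take k (sorted_col_lens A)) a.
Proof.
move=> k0 kn; set s := sorted_col_lens A.
have total_ge : total (fun a b : R => b <= a) by move=> a b; exact: le_total.
have s_sorted : sorted (fun a b : R => b <= a) s by exact: sort_sorted.
have s_size : size s = n by rewrite size_sort size_map size_enum_ord.
have s_perm : perm_eq s [seq col_len A j | j <- enum 'I_n] by rewrite perm_sort.
have s_ge0 a : a \in s -> 0 <= a.
  by rewrite (perm_mem s_perm) => /mapP[j _ ->]; exact: col_len_ge0.
have ks : (k <= size s)%N by rewrite s_size.
(* The inequality is strict: columns tied with the threshold count as small, so those in [L] are all
   among the first [k]. *)
exists [set j | nth 0 s k.-1 < col_len A j]; split=> [|j].
  apply: le_trans (sum_above_threshold_le s_sorted s_ge0 k0 ks).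
  rewrite (perm_big _ s_perm) big_map big_enum_cond /=.
  by rewrite le_eqVlt; apply/orP; left; apply/eqP; apply: eq_bigl => j; rewrite inE.
rewrite inE -leNgt => jL; apply: le_trans (mulr_threshold_le s_sorted k0 ks).
by rewrite ler_wpM2l.
Qed.

Theorem theorem1p4 :
  exists C : R, 0 < C /\
    forall (n : nat) (A : 'M[R]_n) (q : R),
      2 < q -> q <= n%:R ->
      bern_expect (q / n%:R) (fun Q => spec_norm (restr_cols A Q))
      <= C * (Num.sqrt (q / n%:R) * spec_norm A
              + Num.sqrt (ln q) * kcol_norm A (n%:R / q)).
Proof.
(* The short columns contribute [80 * (a + b)] and the long ones [2 * b]. *)
exists 100; split=> [|n A q q2 qn]; first by rewrite ltr0n.
(* Inside R-typed arguments of the definitions, / is parsed as Stdlib's Rdiv. *)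
rewrite !RdivE.
have q0 : 0 < q by lra.
have n0 : 0 < n%:R :> R := lt_le_trans q0 qn.
set p := q / n%:R.
have pn : p * n%:R = q by rewrite /p divfK ?gt_eqF.
have p0 : 0 < p by rewrite /p divr_gt0.
have p01 : 0 <= p <= 1 by rewrite (ltW p0) ler_pdivrMr // mul1r.
have pV : n%:R / q = p^-1 by rewrite /p invf_div.
have x1 : 1 <= n%:R / q by rewrite ler_pdivlMr // mul1r.
set k := Num.truncn (n%:R / q).
have k0 : (0 < k)%N by rewrite /k truncn_gt0.
have /andP[kx xk] := @truncn_itv _ (n%:R / q) (le_trans ler01 x1).
rewrite -/k in kx xk.
have kn : (k <= n)%N.
  rewrite -(ler_nat R); apply: le_trans kx _.
  by rewrite ler_pdivrMr // ler_peMr ?(ltW n0) //; lra.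
have [L [bigL smallL]] := large_columns A k0 kn.
set T := \sum_(a <- _) a in bigL smallL.
set y := n%:R / q.
have -> : kcol_norm A y = p * T by rewrite /kcol_norm {1}/y pV invrK.
set kap := p * T.
have T0 : 0 <= T.
  by apply: le_trans bigL; apply: sumr_ge0 => j _; exact: col_len_ge0.
have kap0 : 0 <= kap by rewrite /kap mulr_ge0 // ltW.
pose A' := restr_cols A (~: L).
have small j : col_len A' j <= 2 * kap.
  have [jL|jL] := boolP (j \in L).
    rewrite /col_len col_restr inE jL scale0r vnormE dot0r sqrtr0.
    by rewrite mulr_ge0.
  rewrite /col_len col_restr inE jL scale1r.
  have k1 : 1 <= k%:R :> R by rewrite ler1n.
  have c0 := col_len_ge0 A j; have := smallL j jL; rewrite -/(col_len A j).
  (* Rounding down loses at most a factor 2: [n / q < k + 1 <= 2 * k]. *)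
  have : 1 <= p * (2 * k%:R).
    apply: (@le_trans _ _ (p * (n%:R / q))); first by rewrite pV divff // gt_eqF.
    by rewrite ler_pM2l //; rewrite -natr1 in xk; lra.
  move=> h1 h2; apply: (@le_trans _ _ (p * (2 * k%:R) * col_len A j)).
    by rewrite ler_peMl.
  have -> : p * (2 * k%:R) * col_len A j = 2 * (p * (k%:R * col_len A j)) by ring.
  by rewrite ler_wpM2l // ler_wpM2l // ltW.
have lnq := half_le_ln q2.
have [N [N0 qN Nln]] := moment_order_exists q2.
have hA' := @bern_spec_norm_le n n A' p (2 * kap) N p01 small N0
  ltac:(by rewrite pn) ltac:(by rewrite pn).
set e := bern_expect _ _ in hA'.
set a := Num.sqrt p * spec_norm A; set b := Num.sqrt (ln q) * kap.
have a0 : 0 <= a by rewrite mulr_ge0 ?sqrtr_ge0 ?spec_norm_ge0.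
have sl0 : 0 <= Num.sqrt (ln q) := sqrtr_ge0 _.
have sl : Num.sqrt (ln q) ^+ 2 = ln q by rewrite sqr_sqrtr //; lra.
have b0 : 0 <= b by rewrite mulr_ge0.
have aE : a ^+ 2 = p * spec_norm A ^+ 2 by rewrite exprMn sqr_sqrtr // ltW.
have bE : b ^+ 2 = ln q * kap ^+ 2 by rewrite exprMn sl.
(* The squared bound is at most [2 * a ^+ 2 + 6144 * b ^+ 2], with [6144 = 512 * 4 * 3], and
   [80 ^+ 2 = 6400]. *)
have e_le : e <= 80 * (a + b).
  have [e0|e0] := ltP e 0; first by apply: le_trans (ltW e0) _; rewrite mulr_ge0 ?addr_ge0.
  rewrite -(@ler_pXn2r _ 2) ?nnegrE // ?mulr_ge0 ?addr_ge0 //.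
  apply: le_trans hA' _.
  have h1 : p * spec_norm A' ^+ 2 <= a ^+ 2.
    rewrite aE ler_pM2l // lerXn2r ?nnegrE ?spec_norm_ge0 //.
    exact: spec_norm_restr_le.
  have h2 : N%:R * kap ^+ 2 <= 3 * b ^+ 2.
    by rewrite bE [in leRHS]mulrA; apply: ler_wpM2r => //; exact: sqr_ge0.
  have h3 : 0 <= a * b by rewrite mulr_ge0.
  have a2 := sqr_ge0 a; have b2 := sqr_ge0 b.
  have -> : 512 * N%:R * (2 * kap) ^+ 2 = 2048 * (N%:R * kap ^+ 2) by ring.
  have -> : (80 * (a + b)) ^+ 2 = 6400 * (a ^+ 2 + 2 * (a * b) + b ^+ 2) by ring.
  lra.
(* The expected total length of the selected long columns is at most [kap], and [kap <= 2 * b] since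
   [Num.sqrt (ln q) >= 1 / 2]. *)
have big_le : p * \sum_(j in L) col_len A j <= 2 * b.
  apply: (@le_trans _ _ kap); first by rewrite ler_pM2l.
  have : 1 / 2 <= Num.sqrt (ln q).
    have half0 : 0 <= 1 / 2 :> R by lra.
    rewrite -(@ler_pXn2r _ 2) ?nnegrE // sl.
    by apply: le_trans lnq; lra.
  by rewrite /b mulrA => h; rewrite ler_peMl //; lra.
apply: (@le_trans _ _ (e + p * \sum_(j in L) col_len A j)); last lra.
have -> : p * \sum_(j in L) col_len A j
    = bern_expect p (fun Q => \sum_(j in Q :&: L) col_len A j).
  rewrite -sum_ind -(bern_expect_sum_mem p).
  congr bern_expect; apply/funext => Q; rewrite -sum_ind.
  by apply: eq_bigr => j _; rewrite inE mulrA -natrM mulnb.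
rewrite -bern_expectD; apply: bern_expect_le => // Q.
rewrite (restr_cols_split A L) (le_trans (spec_normD _ _)) // lerD2l.
exact: spec_norm_restr_sum.
Qed.
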